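(* Let $(A,B)$ be an invertible Jones pair of $n\times n$ matrices over a field $\mathbb F$ whose characteristic is zero or coprime to $2n$. Assume $A$ is symmetric and $\dim \mathcal N_A=m$. Let $W$ be the $2n\times 2n$ type II matrix $$W=\begin{pmatrix}A&B^{(-)}\\ -A&B^{(-)}\end{pmatrix}.$$ Then $\mathcal N_W$ is the Bose–Mesner algebra of an imprimitive association scheme with $2m-1$ classes, which contains the matrix $$\begin{pmatrix}A&-A\\ -A&A\end{pmatrix}.$$ The image under $\Theta_W$ of $\frac12$ times this matrix is the following matrix in the dual scheme (with Bose–Mesner algebra $\mathcal N_{W^T}$): $$\Theta_W\left(\frac12\begin{pmatrix}A&-A\\ -A&A\end{pmatrix}\right)=\begin{pmatrix}0&B\\ B^T&0\end{pmatrix}\in\mathcal N_{W^T}.$$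
   Context: Matrices are over the field $\mathbb F$; $e_i$ is the $i$-th standard basis vector, $I$ the identity matrix and $J$ the all-ones matrix. $\circ$ denotes the entrywise (Schur) product of matrices or vectors of the same size. If a matrix $C$ has no zero entries, $C^{(-)}$ denotes its Schur inverse, $C\circ C^{(-)}=J$. For $C\in M_n(\mathbb F)$ define endomorphisms of $M_n(\mathbb F)$ by $X_C(M)=CM$ and $\Delta_C(M)=C\circ M$. $(A,B)$ is a one-sided Jones pair if $X_A$ and $\Delta_B$ are invertible (i.e. $A^{-1}$ and $B^{(-)}$ exist) and $X_A\Delta_BX_A=\Delta_BX_A\Delta_B$. $(A,B)$ is a Jones pair if both $(A,B)$ and $(A,B^T)$ are one-sided Jones pairs; it is invertible if in addition $A^{(-)}$ and $B^{-1}$ both exist (in which case $A$ and $B$ are type II matrices, as defined next). A $k\times k$ matrix $C$ (with $k$ coprime to the characteristic) is a type II matrix if $C^{(-)}$ exists and $C\,(C^{(-)})^T=kI$. For a type II matrix $C$, its Nomura algebra $\mathcal N_C$ is the set of $k\times k$ matrices $R$ for which every vector $Ce_i\circ C^{(-)}e_j$ is an eigenvector; for $R\in\mathcal N_C$, $\Theta_C(R)$ is the matrix $S$ with $R(Ce_i\circ C^{(-)}e_j)=S_{i,j}\,(Ce_i\circ C^{(-)}e_j)$ for all $i,j$. The Bose–Mesner algebra of a (commutative) association scheme with $d$ classes is the $(d+1)$-dimensional span of the 01-matrices of its relations (including the identity relation); a matrix is said to be contained in the scheme if it lies in this algebra. The scheme is imprimitive if some union of its relations is an equivalence relation other than equality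 and the universal relation. For the type II matrix $W$, the dual scheme is the association scheme whose Bose–Mesner algebra is $\mathcal N_{W^T}$.
   Formalization: Imprimitivity is claimed only for n > 1 (for n = 1 the scheme is the one-class scheme on two points, which is not imprimitive); in positive characteristic the intersection numbers of the association schemes are required to be constant only as elements of the field. *)

(* Defs.v *)
From mathcomp Require Import all_boot all_order all_algebra.

Set Implicit Arguments.
Unset Strict Implicit.
Unset Printing Implicit Defensive.

Import GRing.Theory.
Local Open Scope ring_scope.

Section Matrices.

Variable F : fieldType.

(* [pchar F] is empty when F has characteristic zero, so this says that the
   characteristic of F is zero or coprime to k. *)
Definition char_coprime (k : nat) : Prop :=
  forall p : nat, p \in [pchar F] -> coprime p k.

Definition schur m n (C D : 'M[F]_(m, n)) : 'M[F]_(m, n) :=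
  map2_mx *%R C D.

Definition schur_invertible m n (C : 'M[F]_(m, n)) : Prop :=
  forall i j, C i j != 0.

(* Meaningful only when C has no zero entry: see schur_invP. *)
Definition schur_inv m n (C : 'M[F]_(m, n)) : 'M[F]_(m, n) :=
  map_mx GRing.inv C.

Lemma schur_invP m n (C : 'M[F]_(m, n)) :
  schur_invertible C -> schur C (schur_inv C) = const_mx 1.
Proof. by move=> C0; apply/matrixP=> i j; rewrite !mxE divff. Qed.

Definition Xop n (C M : 'M[F]_n) : 'M[F]_n := C *m M.
Definition Dop n (C M : 'M[F]_n) : 'M[F]_n := schur C M.

(* Xop A is invertible iff A is, and Dop B is invertible iff no entry of B
   vanishes. *)
Definition one_sided_Jones n (A B : 'M[F]_n) : Prop :=
  [/\ A \in unitmx, schur_invertible B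
    & Xop A \o Dop B \o Xop A =1 Dop B \o Xop A \o Dop B].

Definition Jones_pair n (A B : 'M[F]_n) : Prop :=
  one_sided_Jones A B /\ one_sided_Jones A B^T.

Definition invertible_Jones_pair n (A B : 'M[F]_n) : Prop :=
  [/\ Jones_pair A B, schur_invertible A & B \in unitmx].

Definition typeII k (C : 'M[F]_k) : Prop :=
  [/\ char_coprime k, schur_invertible C
    & C *m (schur_inv C)^T = (k%:R)%:M].

Definition nomura_vec k (C : 'M[F]_k) (i j : 'I_k) : 'cV[F]_k :=
  schur (col i C) (col j (schur_inv C)).

(* Being an eigenvector is a linear condition on R, so the Nomura algebra is
   built as a subspace, which gives it a dimension; nomuraP is the usual
   description, the vectors being nonzero by nomura_vec_neq0. *)
Definition nomura k (C : 'M[F]_k) : {vspace 'M[F]_k} :=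
  (\bigcap_(i < k) \bigcap_(j < k)
     (linfun (mulmxr (nomura_vec C i j) : 'M[F]_k -> 'cV[F]_k)
        @^-1: <[nomura_vec C i j]>))%VS.

Lemma nomura_vec_neq0 k (C : 'M[F]_k) i j :
  schur_invertible C -> nomura_vec C i j != 0.
Proof.
move=> C0; apply/negP=> /eqP/matrixP/(_ i 0)/eqP.
by rewrite !mxE mulf_eq0 invr_eq0 !(negPf (C0 _ _)).
Qed.

Lemma nomuraP k (C R : 'M[F]_k) :
  R \in nomura C <->
  forall i j, exists a, R *m nomura_vec C i j = a *: nomura_vec C i j.
Proof.
split=> [RN i j | RN].
  have /subvP/(_ R RN) : (nomura C <= linfun (mulmxr (nomura_vec C i j)
      : 'M[F]_k -> 'cV[F]_k) @^-1: <[nomura_vec C i j]>)%VS.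
    by apply: (bigcapv_inf i) => //; apply: (bigcapv_inf j).
  by rewrite -memv_preim lfunE /= => /vlineP.
rewrite memvE; apply/subv_bigcapP=> i _; apply/subv_bigcapP=> j _.
by rewrite -memvE -memv_preim lfunE /=; apply/vlineP.
Qed.

(* The (i, j) entry is the coordinate of R v on v, for v = nomura_vec C i j;
   it is the eigenvalue of R at v when R lies in the Nomura algebra of C
   (see thetaP). *)
Definition theta k (C R : 'M[F]_k) : 'M[F]_k :=
  \matrix_(i, j) coord [tuple nomura_vec C i j] ord0 (R *m nomura_vec C i j).

Lemma thetaP k (C R S : 'M[F]_k) :
  schur_invertible C -> R \in nomura C ->
  theta C R = S <->
  (forall i j, R *m nomura_vec C i j = S i j *: nomura_vec C i j).
Proof.
move=> C0 /nomuraP RN.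
have coordv i j a : coord [tuple nomura_vec C i j] ord0
                      (a *: nomura_vec C i j) = a.
  have fv : free [tuple nomura_vec C i j] by rewrite seq1_free nomura_vec_neq0.
  by rewrite linearZ /= (coord_free ord0 ord0 fv) mulr1.
split=> [<- i j | RS]; last by apply/matrixP=> i j; rewrite mxE RS coordv.
by have [a Ra] := RN i j; rewrite mxE Ra coordv.
Qed.

End Matrices.

Section Schemes.

Variable F : fieldType.

Definition rel_mx k (r : rel 'I_k) : 'M[F]_k := \matrix_(x, y) (r x y)%:R.

Definition Bose_Mesner k d (S : 'I_d.+1 -> rel 'I_k) : {vspace 'M[F]_k} :=
  (\sum_i <[rel_mx (S i)]>)%VS.

(* Commutative association scheme with d classes: the products of the
   01-matrices of the relations are taken in 'M[F]_k, so in positive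
   characteristic the intersection numbers are those of F; in characteristic
   zero this is the usual counting condition (see scheme_intersection). *)
Record assoc_scheme k d (S : 'I_d.+1 -> rel 'I_k) : Prop := AssocScheme {
  scheme_id : S ord0 =2 eq_op;
  scheme_neq0 : forall i, exists x y, S i x y;
  scheme_part : forall x y, exists! i, S i x y;
  scheme_tr : forall i, exists j, forall x y, S j x y = S i y x;
  scheme_mul : forall i j,
    rel_mx (S i) *m rel_mx (S j) \in Bose_Mesner S;
  scheme_comm : forall i j,
    rel_mx (S i) *m rel_mx (S j) = rel_mx (S j) *m rel_mx (S i)
}.

Lemma Bose_MesnerP k d (S : 'I_d.+1 -> rel 'I_k) (M : 'M[F]_k) :
  M \in Bose_Mesner S <-> exists c : 'I_d.+1 -> F,
    M = \sum_i c i *: rel_mx (S i).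
Proof.
split=> [/memv_sumP [v vS ->] | [c ->]]; last first.
  by apply: memv_sumr => i _; rewrite memvZ ?memv_line.
have vi i : exists a, v i == a *: rel_mx (S i).
  by have /vlineP[a ->] := vS i isT; exists a.
exists (fun i => xchoose (vi i)); apply: eq_bigr => i _.
exact/eqP/(xchooseP (vi i)).
Qed.

Lemma scheme_relE k d (S : 'I_d.+1 -> rel 'I_k) :
  assoc_scheme S -> forall l x y i, S l x y -> S i x y = (i == l).
Proof.
move=> SS l x y i Slxy; have [t [_ tu]] := scheme_part SS x y.
rewrite -(tu _ Slxy).
by apply/idP/eqP=> [/tu | ->] //; rewrite (tu _ Slxy).
Qed.

Lemma dim_Bose_Mesner k d (S : 'I_d.+1 -> rel 'I_k) :
  assoc_scheme S -> \dim (Bose_Mesner S) = d.+1.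
Proof.
move=> SS; have SE := scheme_relE SS.
pose X := [tuple rel_mx (S i) | i < d.+1].
have -> : Bose_Mesner S = <<X>>%VS by rewrite span_def /= big_map big_enum.
suff /eqnP -> : free X by rewrite size_tuple.
have XE (i : 'I_d.+1) : X`_i = rel_mx (S i) by rewrite -tnth_nth tnth_mktuple.
apply/freeP=> c c0 i; have [x [y Sixy]] := scheme_neq0 SS i.
have /matrixP/(_ x y) := c0; rewrite summxE (bigD1 i) //= big1 => [|t ti].
  by rewrite XE !mxE Sixy mulr1 addr0.
by rewrite XE !mxE (SE _ _ _ _ Sixy) (negPf ti) mulr0.
Qed.

Lemma scheme_intersection k d (S : 'I_d.+1 -> rel 'I_k) :
  [pchar F] =i pred0 -> assoc_scheme S ->
  forall i j l, exists p : nat, forall x y, S l x y ->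
    #|[set z | S i x z && S j z y]| = p.
Proof.
move=> F0 SS i j l; have SE := scheme_relE SS.
have [c cE] := (Bose_MesnerP S _).1 (scheme_mul SS i j).
have cnt x y : S l x y -> #|[set z | S i x z && S j z y]|%:R = c l.
  move=> Slxy; have := congr1 (fun M : 'M[F]_k => M x y) cE.
  rewrite summxE (bigD1 l) //= big1 => [|t tl]; last first.
    by rewrite !mxE (SE _ _ _ _ Slxy) (negPf tl) mulr0.
  rewrite !mxE Slxy mulr1 addr0 => <-.
  rewrite -sum1_card natr_sum big_mkcond /=; apply: eq_bigr => z _.
  by rewrite !mxE inE -natrM mulnb; case: (_ && _).
have [x0 [y0 S00]] := scheme_neq0 SS l.
exists #|[set z | S i x0 z && S j z y0]| => x y Sxy.
wlog le_q : x y x0 y0 S00 Sxy /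
    (#|[set z | S i x0 z && S j z y0]| <= #|[set z | S i x z && S j z y]|)%N.
  move=> IH; have [le|/ltnW le] := leqP #|[set z | S i x0 z && S j z y0]|
    #|[set z | S i x z && S j z y]|; first exact: IH.
  by apply/esym/IH.
apply/eqP; rewrite eqn_leq le_q andbT -subn_eq0.
by rewrite -((pcharf0P F).1 F0) natrB // !cnt // subrr eqxx.
Qed.

End Schemes.

Definition imprimitive k d (S : 'I_d.+1 -> rel 'I_k) : Prop :=
  exists I : {set 'I_d.+1},
    let r : rel 'I_k := [rel x y | [exists i in I, S i x y]] in
    [/\ equivalence_rel r, ~ (r =2 eq_op) & ~ (r =2 (fun _ _ => true))].

(* Main.v *)
Require Import Defs.
From mathcomp Require Import all_boot all_order all_algebra ring.
From HB Require Import structures.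

(** Say that [R] is diagonalized by [(C, D)] with eigenvalues [S] when
    [R (C e_i o D e_j) = S_ij (C e_i o D e_j)] for all [i, j]. A one-sided Jones
    pair is a pair for which [A] is diagonalized by [(A, B)] with eigenvalues
    [B], and [N_C] consists of the matrices diagonalized by [(C, C^(-))].

    If [A] is diagonalized by [(C, E)] with an invertible eigenvalue matrix,
    then the matrices diagonalized by [(C, D)] form the centralizer of explicit
    conjugates of [A] by products of columns of [E] and [D]. Comparing these
    centralizers gives [N_A = N_B = N_(B^T)] and, for symmetric [A], that
    [(A, B)] and [(A^(-), B^(-))] diagonalize the same matrices. Moreover
    [Z |-> A o Theta_(B^T)(Z)^T] is a linear bijection from [N_(B^T)] onto the
    matrices diagonalized by [(A, B)].

    The eigenvectors defining [N_W] are of the form [(v, v)] or [(u, -u)], so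
    that [N_W] is the direct sum of the matrices [[X, X], [X, X]] with [X] in
    [N_A] and [[Y, -Y], [-Y, Y]] with [Y] diagonalized by [(A, B)]; its
    dimension is therefore [2m]. The relation pairing [i] with [i + n] is
    [X = I], whence imprimitivity. *)

Set Implicit Arguments.
Unset Strict Implicit.
Unset Printing Implicit Defensive.

Import GRing.Theory.
Local Open Scope ring_scope.

(** * Matrices diagonalized by Schur products of columns *)

Section Eigenvectors.

Variables (F : fieldType) (n : nat).
Implicit Types C D E R S T : 'M[F]_n.

Definition eig C D R S : Prop := forall i j,
  R *m schur (col i C) (col j D) = S i j *: schur (col i C) (col j D).

Definition diag_col D j : 'M[F]_n := diag_mx (col j D)^T.

Lemma mul_diag_colE D C j x y :
  (diag_col D j *m C) x y = D x j * C x y.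
Proof. by rewrite mul_diag_mx !mxE. Qed.

Lemma mul_mx_diag_colE D C j x y :
  (C *m diag_col D j) x y = C x y * D y j.
Proof. by rewrite mul_mx_diag !mxE. Qed.

Lemma eigE C D R S : eig C D R S <->
  forall i j x, \sum_k R x k * (C k i * D k j) = S i j * (C x i * D x j).
Proof.
split=> [RS i j x | RS i j].
  have /matrixP/(_ x 0) := RS i j; rewrite !mxE => <-.
  by apply: eq_bigr => k _; rewrite !mxE.
apply/matrixP=> x y; rewrite !mxE -RS.
by apply: eq_bigr => k _; rewrite !mxE.
Qed.

Lemma diag_colE C D i j : schur (col i C) (col j D) = col i (diag_col D j *m C).
Proof. by apply/matrixP=> x y; rewrite [RHS]mxE mul_diag_colE !mxE mulrC. Qed.

Lemma eig_diag C D R S : eig C D R S <->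
  forall j, R *m (diag_col D j *m C) = diag_col D j *m C *m diag_col S j.
Proof.
split=> [/eigE RS j | RS]; last apply/eigE=> i j x.
  apply/matrixP=> x i; rewrite mul_mx_diag_colE mul_diag_colE !mxE mulrC.
  rewrite [D x j * _]mulrC -RS; apply: eq_bigr => k _.
  by rewrite mul_diag_colE [D k j * _]mulrC.
have /matrixP/(_ x i) := RS j; rewrite mul_mx_diag_colE mul_diag_colE !mxE.
rewrite mulrC [D x j * _]mulrC => <-; apply: eq_bigr => k _.
by rewrite mul_diag_colE [D k j * _]mulrC.
Qed.

Lemma eig_swap C D R S : eig C D R S -> eig D C R S^T.
Proof.
move=> /eigE RS; apply/eigE=> i j x; rewrite !mxE [D x i * _]mulrC -RS.
by apply: eq_bigr => k _; rewrite [D k i * _]mulrC.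
Qed.

Lemma eig0 C D : eig C D 0 0.
Proof. by move=> i j; rewrite mul0mx mxE scale0r. Qed.

Lemma eig_scale C D a R S : eig C D R S -> eig C D (a *: R) (a *: S).
Proof. by move=> RS i j; rewrite -scalemxAl RS scalerA mxE. Qed.

Lemma eig_mul C D R R' S S' :
  eig C D R S -> eig C D R' S' -> eig C D (R *m R') (schur S S').
Proof.
move=> RS RS' i j; rewrite -mulmxA RS' -scalemxAr RS scalerA mxE mulrC.
by congr (_ *: _); rewrite !mxE.
Qed.

Lemma schur_inv_invertible C :
  schur_invertible C -> schur_invertible (schur_inv C).
Proof. by move=> C0 i j; rewrite !mxE invr_eq0. Qed.

Lemma schur_invK C : schur_inv (schur_inv C) = C.
Proof. by apply/matrixP=> i j; rewrite !mxE invrK. Qed.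

Lemma schur_inv_tr C : schur_inv C^T = (schur_inv C)^T.
Proof. by apply/matrixP=> i j; rewrite !mxE. Qed.

Lemma diag_colK D j : schur_invertible D ->
  diag_col D j *m diag_col (schur_inv D) j = 1%:M.
Proof.
move=> D0; rewrite mulmx_diag -diag_const_mx; congr diag_mx.
by apply/matrixP=> x y; rewrite !mxE divff.
Qed.

Lemma diag_col_unit D j : schur_invertible D -> diag_col D j \in unitmx.
Proof. by move=> D0; have /mulmx1_unit[] := diag_colK j D0. Qed.

Lemma eig_inj C D R R' S : C \in unitmx -> schur_invertible D -> (0 < n)%N ->
  eig C D R S -> eig C D R' S -> R = R'.
Proof.
move=> C1 D0 n0 /eig_diag RS /eig_diag RS'; have := RS (Ordinal n0).
rewrite -RS'; apply: (can_inj (mulmxK _)).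
by rewrite unitmx_mul diag_col_unit.
Qed.

(** With G = diag(D_j) C, the equation R G = G diag(S_j) gives C diag(S_j) C^-1 = diag(D_j)^-1 R
    diag(D_j), here read entrywise. *)
Lemma eig_inv C D R S : C \in unitmx -> schur_invertible D -> eig C D R S ->
  forall x k j, \sum_i C x i * S i j * invmx C i k = R x k * D k j / D x j.
Proof.
move=> C1 D0 /eig_diag RS x k j.
have /(congr1 (mulmx^~ (invmx C))) := RS j.
rewrite /= -!mulmxA mulmxV // mulmx1 => /matrixP/(_ x k).
rewrite mul_diag_colE mul_mx_diag_colE => ->.
rewrite [_ / _]mulrC mulrA mulVf // mul1r mxE.
apply: eq_bigr => i _; rewrite mxE (bigD1 i) //= big1 ?addr0 => [|l il].
  by rewrite !mxE eqxx mulr1n mulrA.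
by rewrite !mxE eq_sym (negPf il) mul0r.
Qed.

End Eigenvectors.

Lemma char_coprime_neq0 (F : fieldType) k :
  (0 < k)%N -> char_coprime F k -> k%:R != 0 :> F.
Proof.
move=> k0 Fk; apply/negP=> kF; have [p pF] := natf0_pchar k0 kF.
have := Fk p pF; rewrite prime_coprime ?(pcharf_prime pF) //.
by rewrite (dvdn_pcharf pF) kF.
Qed.

(** * Type II matrices and the duality of Nomura algebras *)

Section TypeII.

Variables (F : fieldType) (n : nat).
Hypothesis n_gt0 : (0 < n)%N.
Implicit Types C D R S : 'M[F]_n.

Lemma typeII_mulC C : typeII C -> (schur_inv C)^T *m C = n%:R%:M.
Proof.
move=> [Fn C0 CC]; have n0 := char_coprime_neq0 n_gt0 Fn.
have /mulmx1C : C *m (n%:R^-1 *: (schur_inv C)^T) = 1%:M.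
  by rewrite -scalemxAr CC scale_scalar_mx mulVf.
rewrite -scalemxAl => /(congr1 ( *:%R n%:R)).
by rewrite scalerA divff // scale1r scale_scalar_mx mulr1.
Qed.

Lemma typeII_unit C : typeII C -> C \in unitmx.
Proof.
move=> [Fn C0 CC]; have n0 := char_coprime_neq0 n_gt0 Fn.
have /mulmx1_unit[] // : C *m (n%:R^-1 *: (schur_inv C)^T) = 1%:M.
by rewrite -scalemxAr CC scale_scalar_mx mulVf.
Qed.

Lemma typeII_invmx C : typeII C -> invmx C = n%:R^-1 *: (schur_inv C)^T.
Proof.
move=> CII; have [Fn _ CC] := CII; have n0 := char_coprime_neq0 n_gt0 Fn.
apply: (can_inj (mulKmx (typeII_unit CII))); rewrite mulmxV ?typeII_unit //.
by rewrite -scalemxAr CC scale_scalar_mx mulVf.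
Qed.

Lemma typeII_tr C : typeII C -> typeII C^T.
Proof.
move=> CII; have [Fn C0 _] := CII; split=> // [i j|]; first by rewrite mxE.
by rewrite schur_inv_tr -trmx_mul typeII_mulC // tr_scalar_mx.
Qed.

Lemma typeII_schur_inv C : typeII C -> typeII (schur_inv C).
Proof.
move=> [Fn C0 CC]; split=> //; first exact: schur_inv_invertible.
by rewrite schur_invK -[LHS]trmxK trmx_mul trmxK CC tr_scalar_mx.
Qed.

Lemma eig_typeII C D R S : typeII C -> schur_invertible D -> eig C D R S ->
  forall x k j, \sum_i C x i * S i j / C k i =
    n%:R * (R x k * D k j / D x j).
Proof.
move=> CII D0 RS x k j; have [Fn C0 _] := CII.
have n0 := char_coprime_neq0 n_gt0 Fn.
rewrite -(eig_inv (typeII_unit CII) D0 RS) mulr_sumr; apply: eq_bigr => i _.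
by rewrite typeII_invmx // !mxE mulrCA mulVKf.
Qed.

(** For [D] the Schur inverse of [C], the identity of [eig_typeII] is itself an eigenvector
    equation, for [S^T] on products of rows. This duality between the Nomura algebras of [C] and
    [C^T] exchanges matrix and Schur products. *)
Lemma eig_dual C R S : typeII C -> eig C (schur_inv C) R S ->
  eig C^T (schur_inv C^T) S^T (n%:R *: R).
Proof.
move=> CII RS; have [_ C0 _] := CII; have Ci0 := schur_inv_invertible C0.
apply/eigE=> x k j; rewrite !mxE;
have := eig_typeII CII Ci0 RS x k j; rewrite !mxE.
rewrite invrK -!mulrA [_^-1 * _]mulrC => <-.
by apply: eq_bigr => i _; rewrite !mxE mulrA [S _ _ * _]mulrC.
Qed.

(** Up to the factor n, the Schur inverses of a basis of eigenvectors form the dual basis, on which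
    [R^T] has the same eigenvalues. *)
Lemma eig_trmx C D R S : typeII C -> schur_invertible D -> eig C D R S ->
  eig (schur_inv C) (schur_inv D) R^T S.
Proof.
move=> CII D0 /eig_diag RS; apply/eig_diag=> j.
have [Fn _ _] := CII; have n0 := char_coprime_neq0 n_gt0 Fn.
set G := diag_col D j *m C; set G' := diag_col _ j *m schur_inv C.
have GG : G'^T *m G = n%:R%:M.
  rewrite trmx_mul tr_diag_mx -mulmxA [X in _ *m X]mulmxA.
  by rewrite (mulmx1C (diag_colK j D0)) mul1mx typeII_mulC.
have Gu : G^T \in unitmx.
  by rewrite unitmx_tr unitmx_mul diag_col_unit ?typeII_unit.
have RG : R *m G = G *m diag_col S j := RS j.
clearbody G G'; apply: (can_inj (mulKmx Gu)); apply: trmx_inj.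
rewrite !trmx_mul !trmxK -!mulmxA RG tr_diag_mx.
by rewrite [LHS]mulmxA !GG scalar_mxC.
Qed.

Lemma nomura_eig C R : schur_invertible C ->
  R \in nomura C -> eig C (schur_inv C) R (theta C R).
Proof. by move=> C0 RN; apply/(thetaP _ C0 RN). Qed.

Lemma eig_nomura C R S : eig C (schur_inv C) R S -> R \in nomura C.
Proof.
by move=> RS; apply/(nomuraP _ _).2 => i j; exists (S i j); apply: RS.
Qed.

Lemma eig_theta C R S : schur_invertible C ->
  eig C (schur_inv C) R S -> theta C R = S.
Proof. by move=> C0 RS; apply/thetaP=> //; apply: eig_nomura RS. Qed.

Section NomuraClosure.

Variable C : 'M[F]_n.
Hypothesis CII : typeII C.

Let C0 : schur_invertible C. Proof. by case: CII. Qed.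
Let n0 : n%:R != 0 :> F. Proof. by case: CII => /(char_coprime_neq0 n_gt0). Qed.

Lemma nomura_mul R R' :
  R \in nomura C -> R' \in nomura C -> R *m R' \in nomura C.
Proof.
move=> /(nomura_eig C0) RS /(nomura_eig C0) RS'.
exact: eig_nomura (eig_mul RS RS').
Qed.

Lemma nomura_comm R R' :
  R \in nomura C -> R' \in nomura C -> R *m R' = R' *m R.
Proof.
move=> /(nomura_eig C0) RS /(nomura_eig C0) RS'.
have Ci0 := schur_inv_invertible C0.
apply: (eig_inj (typeII_unit CII) Ci0 n_gt0 (eig_mul RS RS')).
suff -> : schur (theta C R) (theta C R') = schur (theta C R') (theta C R).
  exact: eig_mul.
by apply/matrixP=> i j; rewrite !mxE mulrC.
Qed.

Lemma nomura_trmx R : R \in nomura C -> R^T \in nomura C.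
Proof.
move=> /(nomura_eig C0) /(eig_trmx CII (schur_inv_invertible C0)).
by rewrite schur_invK => /eig_swap /eig_nomura.
Qed.

Lemma theta_tr_nomura R : R \in nomura C -> (theta C R)^T \in nomura C^T.
Proof. by move=> /(nomura_eig C0) /(eig_dual CII) /eig_nomura. Qed.

End NomuraClosure.

(** Dualize, multiply in the algebra of [C^T], and dualize back: this gives the transpose of n^2
    times the Schur product. *)
Lemma nomura_schur C R R' : typeII C ->
  R \in nomura C -> R' \in nomura C -> schur R R' \in nomura C.
Proof.
move=> CII; have [Fn C0 _] := CII; have n0 := char_coprime_neq0 n_gt0 Fn.
move=> /(nomura_eig C0) /(eig_dual CII) RS /(nomura_eig C0) /(eig_dual CII) RS'.
have := eig_dual (typeII_tr CII) (eig_mul RS RS').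
rewrite !trmxK => /eig_nomura /(nomura_trmx CII); rewrite trmxK.
have -> : schur (n%:R *: R) (n%:R *: R') = n%:R ^+ 2 *: schur R R'.
  by apply/matrixP=> i j; rewrite !mxE mulrACA expr2.
by move=> /(memvZ (n%:R ^- 2)); rewrite scalerA mulVf ?scale1r ?expf_neq0.
Qed.

Lemma nomura_1 C : 1%:M \in nomura C.
Proof. by apply/(nomuraP _ _).2 => i j; exists 1; rewrite mul1mx scale1r. Qed.

(** The all-ones matrix is dual to the identity, all of whose eigenvalues are 1. *)
Lemma nomura_J C : typeII C -> const_mx 1 \in nomura C.
Proof.
move=> CII; have [Fn C0 _] := CII; have n0 := char_coprime_neq0 n_gt0 Fn.
have : eig C^T (schur_inv C^T) 1%:M (const_mx 1).
  by move=> i j; rewrite mul1mx mxE scale1r.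
move=> /(eig_dual (typeII_tr CII)); rewrite !trmxK trmx_const.
by move=> /eig_nomura.
Qed.

(** n R_zz is the sum of a column of [theta C R], whatever z is. *)
Lemma nomura_diag C R : typeII C -> R \in nomura C ->
  forall x y, R x x = R y y.
Proof.
move=> CII; have [Fn C0 _] := CII; have n0 := char_coprime_neq0 n_gt0 Fn.
move=> /(nomura_eig C0) /(eig_typeII CII (schur_inv_invertible C0)) RS x y.
apply: (mulfI n0); pose j := Ordinal n_gt0.
have RE z : n%:R * R z z = \sum_i theta C R i j.
  have := RS z z j; rewrite mulfK ?schur_inv_invertible // => <-.
  by apply: eq_bigr => i _; rewrite mulrAC divff // mul1r.
by rewrite !RE.
Qed.

End TypeII.

(** * Association schemes from algebras closed under both products *)

Section SchemeOfAlgebra.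

Variables (F : fieldType) (k : nat) (V : {vspace 'M[F]_k}).
Hypothesis VJ : const_mx 1 \in V.
Hypothesis Vschur : forall M N, M \in V -> N \in V -> schur M N \in V.

(** Two positions share a signature exactly when no matrix of [V] separates them; the fibres become
    the relations of the scheme. *)
Definition signature (p : 'I_k * 'I_k) : {ffun 'I_(\dim V) -> F} :=
  [ffun i : 'I_(\dim V) => (vbasis V)`_i p.1 p.2].

Lemma signatureP p q :
  signature p = signature q <-> forall M, M \in V -> M p.1 p.2 = M q.1 q.2.
Proof.
split=> [pq M /coord_vbasis -> | pq]; last first.
  by apply/ffunP=> i; rewrite !ffunE pq ?vbasis_mem ?mem_nth ?size_tuple.
rewrite !summxE; apply: eq_bigr => i _; rewrite !mxE.
by have /ffunP/(_ i) := pq; rewrite !ffunE => ->.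
Qed.

(** Interpolation: a basis matrix separating [q] from [p0], shifted by a multiple of the all-ones
    matrix and rescaled, is 0 at [q] and 1 at [p0]. The Schur product over all [q] is the
    indicator. *)
Lemma signature_indicator p0 :
  \matrix_(x, y) (signature (x, y) == signature p0)%:R \in V.
Proof.
have sep q : exists L, [/\ L \in V, L p0.1 p0.2 = 1
    & signature q != signature p0 -> L q.1 q.2 = 0].
  have [_ | qp] := eqVneq (signature q) (signature p0).
    by exists (const_mx 1); rewrite mxE.
  have [i] : exists i, signature q i != signature p0 i.
    apply/existsP; apply: contraR qp; rewrite negb_exists => /forallP qp.
    by apply/eqP/ffunP=> i; apply/eqP; rewrite -[_ == _]negbK.
  rewrite !ffunE; set b := _`_i; rewrite eq_sym -subr_eq0 => bqp.
  have bV : b \in V by rewrite vbasis_mem ?mem_nth ?size_tuple.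
  exists ((b p0.1 p0.2 - b q.1 q.2)^-1 *: (b - b q.1 q.2 *: const_mx 1)).
  by rewrite memvZ ?memvB ?memvZ // !mxE mulr1 mulVf // subrr mulr0.
have [L LP] := fin_all_exists sep.
have LV s : \matrix_(x, y) \prod_(q <- s) L q x y \in V.
  elim: s => [|q s IHs].
    suff -> : \matrix_(x, y) \prod_(q <- [::]) L q x y = const_mx 1 by [].
    by apply/matrixP=> x y; rewrite !mxE big_nil.
  have [LqV _ _] := LP q; move: (Vschur LqV IHs); congr (_ \in V).
  by apply/matrixP=> x y; rewrite !mxE big_cons.
move: (LV (enum {: 'I_k * 'I_k})); congr (_ \in V).
apply/matrixP=> x y; rewrite !mxE; have [xy | xy] := eqVneq.
  apply: big1 => q _; have [LqV Lq1 _] := LP q.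
  by have /signatureP/(_ _ LqV) /= -> := xy.
rewrite big_enum (bigD1 (x, y)) //=; have [_ _ /(_ xy) /= ->] := LP (x, y).
by rewrite mul0r.
Qed.

Hypothesis k_gt0 : (0 < k)%N.
Hypothesis V1 : 1%:M \in V.
Hypothesis Vmul : forall M N, M \in V -> N \in V -> M *m N \in V.
Hypothesis Vcomm : forall M N, M \in V -> N \in V -> M *m N = N *m M.
Hypothesis Vtrmx : forall M, M \in V -> M^T \in V.
Hypothesis Vdiag : forall M, M \in V -> forall x y, M x x = M y y.

Theorem algebra_scheme : exists d (S : 'I_d.+1 -> rel 'I_k),
  assoc_scheme F S /\ Bose_Mesner F S = V.
Proof.
pose o := Ordinal k_gt0; pose c0 := signature (o, o).
(* The signature of the diagonal comes first, since relation [ord0] must be equality. *)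
pose cs := c0 :: filter (predC1 c0) (undup (map signature (enum predT))).
have cs_uniq : uniq cs.
  by rewrite /= filter_uniq ?undup_uniq // mem_filter /= eqxx.
have sig_cs p : signature p \in cs.
  rewrite inE mem_filter mem_undup /=.
  by rewrite map_f ?mem_enum // andbT orbN.
pose d := size (filter (predC1 c0) (undup (map signature (enum predT)))).
pose S (i : 'I_d.+1) : rel 'I_k := fun x y => signature (x, y) == cs`_i.
have wit (i : 'I_d.+1) : exists p, signature p = cs`_i.
  have : cs`_i \in cs by rewrite mem_nth.
  rewrite inE mem_filter mem_undup => /orP[/eqP-> | ]; first by exists (o, o).
  by case/andP=> _ /mapP[p _ ->]; exists p.
have SV i : rel_mx F (S i) \in V.
  have [p pi] := wit i; move: (signature_indicator p); congr (_ \in V).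
  by apply/matrixP=> x y; rewrite !mxE /S pi.
have VS : Bose_Mesner F S = V.
  apply/eqP; rewrite eqEsubv; apply/andP; split; apply/subvP=> M.
    move=> /Bose_MesnerP[c ->]; apply: memv_suml => i _.
    by rewrite memvZ.
  move=> MV; apply/Bose_MesnerP; have [w wP] := fin_all_exists wit.
  exists (fun i => M (w i).1 (w i).2); apply/matrixP=> x y.
  have := sig_cs (x, y) => /(nthP 0)[i id ci]; pose i' : 'I_d.+1 := Ordinal id.
  rewrite summxE (bigD1 i') //= big1 => [|l li].
    rewrite !mxE /S ci eqxx mulr1 addr0.
    by apply: (signatureP (x, y) _).1 => //; rewrite wP.
  rewrite !mxE /S -ci (nth_uniq 0) //=.
  case: eqP => [il|]; last by rewrite mulr0.
  by case/eqP: li; apply/val_inj.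
exists d, S; split=> //; split.
(* [V1] separates the diagonal from the other positions, and [Vdiag] makes it a single class. *)
- move=> x y; rewrite /S /=; apply/eqP/eqP => [|->].
    move=> /signatureP/(_ _ V1); rewrite !mxE eqxx; case: eqP => // _ /eqP.
    by rewrite eq_sym oner_eq0.
  by apply/signatureP=> M /Vdiag; apply.
- by move=> i; have [[x y] xyi] := wit i; exists x, y; rewrite /S xyi.
- move=> x y; have := sig_cs (x, y) => /(nthP 0)[i id ci].
  exists (Ordinal id); split=> [|j]; first by rewrite /S ci.
  by rewrite /S -ci (nth_uniq 0) // => /eqP ij; apply/val_inj.
- move=> i; have [[x0 y0] xyi] := wit i.
  have := sig_cs (y0, x0) => /(nthP 0)[j jd cj].
  exists (Ordinal jd) => x y; rewrite /S /= cj -xyi.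
  by apply/eqP/eqP => /signatureP xy; apply/signatureP=> M /Vtrmx /xy;
     rewrite !mxE.
- by move=> i j; rewrite VS Vmul.
- by move=> i j; apply: Vcomm.
Qed.

End SchemeOfAlgebra.

Lemma nomura_scheme (F : fieldType) n (C : 'M[F]_n) : (0 < n)%N -> typeII C ->
  exists d (S : 'I_d.+1 -> rel 'I_n),
    assoc_scheme F S /\ Bose_Mesner F S = nomura C.
Proof.
move=> n0 CII; apply: algebra_scheme => //.
- exact: nomura_J.
- by move=> M N; apply: nomura_schur.
- exact: nomura_1.
- by move=> M N; apply: nomura_mul.
- by move=> M N; apply: nomura_comm.
- by move=> M; apply: nomura_trmx.
- by move=> M; apply: nomura_diag.
Qed.

Lemma Bose_Mesner_relation (F : fieldType) k d (S : 'I_d.+1 -> rel 'I_k)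
    (r : rel 'I_k) : assoc_scheme F S -> rel_mx F r \in Bose_Mesner F S ->
  exists I : {set 'I_d.+1}, r =2 [rel x y | [exists i in I, S i x y]].
Proof.
move=> SS /Bose_MesnerP[c rc]; have SE := scheme_relE SS.
exists [set i | c i != 0] => x y; have [l [Slxy _]] := scheme_part SS x y.
have /matrixP/(_ x y) := rc; rewrite summxE (bigD1 l) //= big1 => [|t tl].
  rewrite !mxE Slxy mulr1 addr0 => rl; apply/idP/existsP=> [rxy | [i]].
    by exists l; rewrite Slxy inE -rl rxy oner_eq0.
  rewrite inE (SE _ _ _ _ Slxy) andbC => /andP[/eqP->].
  by rewrite -rl; case: (r x y); rewrite ?eqxx.
by rewrite !mxE (SE _ _ _ _ Slxy) (negPf tl) mulr0.
Qed.

(** * Invertible Jones pairs consist of type II matrices *)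

Section Jones.

Variables (F : fieldType) (n : nat).
Implicit Types A B C D E R S T : 'M[F]_n.

(** Apply both operators to the matrix unit [delta_mx i j] and compare column [j]. *)
Lemma one_sided_Jones_eig A B : one_sided_Jones A B -> eig A B A B.
Proof.
move=> [_ _ AB]; apply/eigE=> i j x.
have /matrixP/(_ x j) := AB (delta_mx i j); rewrite /Xop /Dop /= !mxE.
have deltaE C y : (C *m delta_mx i j) y j = C y i.
  rewrite mxE (bigD1 i) //= big1 => [|l li].
    by rewrite !mxE !eqxx mulr1 addr0.
  by rewrite !mxE (negPf li) mulr0.
rewrite [X in _ = _ * X](bigD1 i) //= [X in _ = _ * (_ + X)]big1; last first.
  by move=> l li; rewrite !mxE (negPf li) !mulr0.
rewrite addr0 !mxE !eqxx mulr1 mulrA [_ * B i j]mulrC [B x j * _]mulrC => <-.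
by apply: eq_bigr => l _; rewrite mxE deltaE [A l i * _]mulrC.
Qed.

(** The eigenvector equations give the braid relation A d A = d A d with d = diag(B_j), so [A] is
    conjugate to d and has the same trace. *)
Lemma Jones_col_sum A B j : one_sided_Jones A B -> \sum_i B i j = \tr A.
Proof.
move=> JAB; have [Au B0 _] := JAB.
have /eig_diag/(_ j) := one_sided_Jones_eig JAB.
set d := diag_col B j => AdA; have du : d \in unitmx by rewrite diag_col_unit.
have -> : A = d *m A *m d *m invmx (d *m A).
  by rewrite -AdA mulmxK // unitmx_mul du.
rewrite mxtrace_mulC mulKmx ?unitmx_mul ?du //.
by rewrite mxtrace_diag; apply: eq_bigr => i _; rewrite !mxE.
Qed.

Hypothesis n_gt0 : (0 < n)%N.
Hypothesis Fn : char_coprime F n.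
Let n0 : n%:R != 0 :> F. Proof. exact: char_coprime_neq0 Fn. Qed.

Section InvertiblePair.

Variables A B : 'M[F]_n.
Hypothesis JAB : invertible_Jones_pair A B.

Let Au : A \in unitmx. Proof. by case: JAB => [[[]]]. Qed.
Let A0 : schur_invertible A. Proof. by case: JAB. Qed.
Let Bu : B \in unitmx. Proof. by case: JAB. Qed.
Let B0 : schur_invertible B. Proof. by case: JAB => [[[]]]. Qed.
Let JB : one_sided_Jones A B. Proof. by case: JAB => [[]]. Qed.
Let JBt : one_sided_Jones A B^T. Proof. by case: JAB => [[]]. Qed.
Let eAB : eig A B A B. Proof. exact: one_sided_Jones_eig JB. Qed.

(** By [eig_inv] with k = x, the row of all A_xk (A^-1)_kx times [B] is constant. The column sums of
    [B] all equal tr A, which is nonzero as [B] is invertible, so the row itself is constant; its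
    entries sum to 1, so each is 1/n. *)
Lemma invertible_Jones_typeII_l : typeII A.
Proof.
split=> //; have trA0 : \tr A != 0.
  apply/eqP=> trA; have : const_mx 1 *m B = 0 :> 'rV_n.
    apply/matrixP=> x j; rewrite !mxE.
    rewrite -[RHS]trA -(Jones_col_sum j JB).
    by apply: eq_bigr => i _; rewrite mxE mul1r.
  move=> /(congr1 (mulmx^~ (invmx B))) /=; rewrite mulmxK // mul0mx.
  by move=> /matrixP/(_ 0 (Ordinal n_gt0))/eqP; rewrite !mxE oner_eq0.
have row_const x :
    (\row_k (A x k * invmx A k x)) = (A x x / \tr A) *: const_mx 1.
  apply: (can_inj (mulmxK Bu)); apply/matrixP=> z j.
  rewrite -scalemxAl !mxE.
  have -> : \sum_k const_mx 1 z k * B k j = \tr A.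
    by rewrite -(Jones_col_sum j JB); apply: eq_bigr => i _; rewrite mxE mul1r.
  rewrite divfK //; have := eig_inv Au B0 eAB x x j; rewrite mulfK // => <-.
  by apply: eq_bigr => k _; rewrite mxE mulrAC.
have AVA x k : A x k * invmx A k x = A x x / \tr A.
  by have /matrixP/(_ 0 k) := row_const x; rewrite !mxE mulr1.
have AxxE x : A x x / \tr A = n%:R^-1.
  apply: (mulfI n0); rewrite divff //.
  have AV : \sum_k A x k * invmx A k x = 1.
    by have /matrixP/(_ x x) := mulmxV Au; rewrite !mxE eqxx.
  rewrite -[RHS]AV (eq_bigr (fun=> A x x / \tr A)) => [|k _]; last exact: AVA.
  by rewrite sumr_const card_ord mulr_natl.
have -> : (schur_inv A)^T = n%:R *: invmx A.
  apply/matrixP=> k x; rewrite !mxE; apply: (mulfI (A0 x k)).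
  by rewrite mulrCA AVA AxxE !divff.
by rewrite -scalemxAr mulmxV // scale_scalar_mx mulr1.
Qed.

(** By [eig_inv], A_xy times the sum over j of B_yj / B_xj is the (x, y) entry of A diag(row sums of
    B) A^-1. The pair (A, B^T) makes these row sums equal, so the entry vanishes for x != y. *)
Lemma invertible_Jones_typeII_r : typeII B.
Proof.
split=> //; apply/matrixP=> y x; rewrite !mxE.
have [-> | xy] := eqVneq y x.
  rewrite (eq_bigr (fun=> 1)) => [|j _]; last by rewrite !mxE divff.
  by rewrite sumr_const card_ord mulr1n.
rewrite mulr0n; apply: (mulfI (A0 x y)); rewrite mulr0 mulr_sumr.
have -> : \sum_j A x y * (B y j * (schur_inv B)^T j x) =
    \sum_j \sum_k A x k * B k j * invmx A k y.
  by apply: eq_bigr => j _; rewrite (eig_inv Au B0 eAB) !mxE mulrA.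
rewrite exchange_big /=.
rewrite (eq_bigr (fun k => \tr A * (A x k * invmx A k y))) => [|k _].
  have /matrixP/(_ x y) := mulmxV Au; rewrite -mulr_sumr !mxE => ->.
  by rewrite eq_sym (negPf xy) mulr0.
rewrite -(Jones_col_sum k JBt) mulr_suml; apply: eq_bigr => j _.
by rewrite mxE mulrCA mulrA.
Qed.

End InvertiblePair.

(** The conjugate of [A] by diag(D_j) diag(E_i)^-1. Only the ratio of D_j to E_i matters, so
    different pairs can yield the same family. *)
Definition scaled_conj A D E i j : 'M[F]_n :=
  \matrix_(x, y) (A x y * E y i * D x j / (E x i * D y j)).

(* The eigenvector equations for [A] say that [diag(E_i)^-1 A diag(E_i)],
   with [E_i] the columns of [E], is diagonalized by the columns of [C]; as the
   eigenvalue lists are the columns of an invertible [T], these matrices span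
   the full algebra of matrices diagonalized by [C], which is its own
   centralizer. *)
Lemma eig_commutant A C D E R T :
    C \in unitmx -> T \in unitmx -> schur_invertible D -> schur_invertible E ->
    eig C E A T ->
  (exists S, eig C D R S) <->
  forall i j, R *m scaled_conj A D E i j = scaled_conj A D E i j *m R.
Proof.
move=> Cu Tu D0 E0 /eigE AT.
pose K := scaled_conj A D E.
have Gu j : diag_col D j *m C \in unitmx by rewrite unitmx_mul diag_col_unit.
have KE i j : K i j *m (diag_col D j *m C) = diag_col D j *m C *m diag_col T i.
  apply/matrixP=> x l; rewrite mul_mx_diag_colE mul_diag_colE mxE.
  transitivity (D x j / E x i * (T l i * (C x l * E x i))).
    rewrite -AT mulr_sumr; apply: eq_bigr => y _; rewrite mul_diag_colE mxE.
    by field; rewrite E0 D0.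
  by field; rewrite E0.
split=> [[S /eig_diag RS] i j | RK].
  have [KG RG] := (KE i j, RS j); move: (Gu j) KG RG.
  move: (diag_col D j *m C) => G {}Gu KG RG.
  apply: (can_inj (mulmxK Gu)); rewrite -/(K i j) -!mulmxA KG RG.
  by rewrite !mulmxA RG KG -!mulmxA; congr (_ *m _); apply: diag_mxC.
suff RS j : exists s : 'I_n -> F, forall i,
   R *m schur (col i C) (col j D) = s i *: schur (col i C) (col j D).
  have [s sE] := fin_all_exists RS; exists (\matrix_(i, j) s j i) => i j.
  by rewrite mxE; apply: sE.
pose G := diag_col D j *m C; have Gj : G \in unitmx := Gu j.
have KG i : K i j *m G = G *m diag_col T i := KE i j.
have vE i : schur (col i C) (col j D) = col i G by rewrite diag_colE.
have {}RK i : R *m K i j = K i j *m R := RK i j.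
clearbody G; pose N := invmx G *m (R *m G).
have GN : G *m N = R *m G by rewrite mulKVmx.
clearbody N.
have NT i : N *m diag_col T i = diag_col T i *m N.
  apply: (can_inj (mulKmx Gj)); rewrite !mulmxA GN -KG.
  by rewrite -[RHS]mulmxA GN -mulmxA -KG !mulmxA RK.
(* [N] is [R] in the basis [G]. A nonzero [N x y] would make rows x and y of [T] equal, against its
   invertibility. *)
have Ndiag x y : x != y -> N x y = 0.
  move=> xy; apply/eqP/negP=> /negP Nxy; case/negP: xy.
  have TT : (delta_mx 0 x - delta_mx 0 y) *m T = 0 :> 'rV_n.
    rewrite mulmxBl -!rowE; apply/matrixP=> z i; rewrite !mxE.
    apply/eqP; rewrite subr_eq0; apply/eqP/(mulfI Nxy).
    have /matrixP/(_ x y) := NT i.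
    by rewrite mul_mx_diag_colE mul_diag_colE => ->; rewrite mulrC.
  have /matrixP/(_ 0 x) : delta_mx 0 x - delta_mx 0 y = 0 :> 'rV[F]_n.
    by rewrite -[LHS](mulmxK Tu) TT mul0mx.
  rewrite !mxE !eqxx /=; case: eqP => // _ /eqP.
  by rewrite subr0 oner_eq0.
exists (fun i => N i i) => i; rewrite vE colE mulmxA -GN -colE -colE.
apply/matrixP=> x y; rewrite !mxE (bigD1 i) //= big1 => [|l li].
  by rewrite addr0 mulrC.
by rewrite Ndiag ?mulr0.
Qed.

End Jones.

(** * Nomura algebras of a Jones pair and the matrices it diagonalizes *)

Section JonesNomura.

Variables (F : fieldType) (n : nat).
Implicit Types A B C D E R S T : 'M[F]_n.
Hypothesis n_gt0 : (0 < n)%N.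

Lemma typeII_eig C D R S : typeII C -> schur_invertible D ->
  (forall x k j, \sum_i C x i * S i j / C k i =
    n%:R * (R x k * D k j / D x j)) -> eig C D R S.
Proof.
move=> CII D0 RS; apply/eigE=> i j x; have [Fn C0 _] := CII.
have n0 := char_coprime_neq0 n_gt0 Fn; apply: (mulfI n0).
rewrite mulr_sumr.
transitivity (\sum_k \sum_l
    D x j * C x l * S l j * ((schur_inv C)^T l k * C k i)).
  apply: eq_bigr => k _.
  transitivity (D x j * C k i * (n%:R * (R x k * D k j / D x j))).
    by field; apply: D0.
  by rewrite -RS mulr_sumr; apply: eq_bigr => l _; rewrite !mxE; ring.
have CC l : \sum_k D x j * C x l * S l j * ((schur_inv C)^T l k * C k i) =
    D x j * C x l * S l j * (n%:R)%:M l i.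
  by rewrite -(typeII_mulC n_gt0 CII) mxE mulr_sumr.
rewrite exchange_big /= (bigD1 i) //= [X in _ + X]big1 => [|l li].
  by rewrite CC mxE eqxx addr0 mulr1n; ring.
by rewrite CC mxE (negPf li) mulr0n mulr0.
Qed.

Lemma nomura_exP C R : schur_invertible C ->
  R \in nomura C <-> exists S, eig C (schur_inv C) R S.
Proof.
move=> C0; split=> [/(nomura_eig C0) | [S /eig_nomura //]].
by exists (theta C R).
Qed.

Lemma invertible_Jones_pair_tr A B :
  invertible_Jones_pair A B -> invertible_Jones_pair A B^T.
Proof.
move=> [[JAB JABt] A0 Bu]; split; rewrite ?unitmx_tr //.
by split; rewrite ?trmxK.
Qed.

(** In the centralizer description, the ratio D_j / E_i is 1/(A_j B_i) for the algebra of [A] and,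
    with indices exchanged, 1/(B_i A_j) for that of [B]: the conjugates of [A] are the same. *)
Lemma nomura_Jones A B : char_coprime F n -> invertible_Jones_pair A B ->
  nomura A = nomura B.
Proof.
move=> Fn JAB; have [[[Au B0 AB] _] A0 Bu] := JAB.
have eAB : eig A B A B by apply: one_sided_Jones_eig.
have Ai0 := schur_inv_invertible A0; have Bi0 := schur_inv_invertible B0.
have Btu : B^T \in unitmx by rewrite unitmx_tr.
apply/vspaceP=> R.
have RA := iff_trans (nomura_exP R A0) (eig_commutant R Au Bu Ai0 B0 eAB).
have RB := iff_trans (nomura_exP R B0)
  (eig_commutant R Bu Btu Bi0 A0 (eig_swap eAB)).
have KE i j :
    scaled_conj A (schur_inv A) B i j = scaled_conj A (schur_inv B) A j i.
  by apply/matrixP=> x y; rewrite !mxE; field; rewrite !A0 !B0.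
by apply/idP/idP=> [/RA RK | /RB RK]; [apply/RB | apply/RA] => i j;
  rewrite ?KE // -KE.
Qed.

(** [eig_trmx] and the symmetry of [A] give eigenvector equations of [A] for the inverted pair. The
    conjugating ratios are A_j / A_i on one side and A_i / A_j on the other, the same family with
    indices exchanged. *)
Lemma eig_schur_inv_Jones A B R : char_coprime F n -> A^T = A ->
    invertible_Jones_pair A B ->
  (exists S, eig A B R S) <-> (exists S, eig (schur_inv B) (schur_inv A) R S).
Proof.
move=> Fn symA JAB; have [[[Au B0 AB] _] A0 Bu] := JAB.
have AII := invertible_Jones_typeII_l n_gt0 Fn JAB.
have BII := invertible_Jones_typeII_r Fn JAB.
have eAB : eig A B A B by apply: one_sided_Jones_eig.
have Ai0 := schur_inv_invertible A0; have Bi0 := schur_inv_invertible B0.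
have Btu : B^T \in unitmx by rewrite unitmx_tr.
have Biu := typeII_unit n_gt0 (typeII_schur_inv BII).
have eABi := eig_swap (eig_trmx n_gt0 AII B0 eAB); rewrite symA in eABi.
have RA := eig_commutant R Bu Btu A0 A0 (eig_swap eAB).
have RB := eig_commutant R Biu Btu Ai0 Ai0 eABi.
have KE i j :
    scaled_conj A A A i j = scaled_conj A (schur_inv A) (schur_inv A) j i.
  by apply/matrixP=> x y; rewrite !mxE; field; rewrite oner_neq0 !A0.
have RC : (exists S, eig A B R S) <-> (exists S, eig B A R S).
  by split=> -[S /eig_swap RS]; exists S^T.
apply: (iff_trans RC); split=> [/RA RK | /RB RK]; [apply/RB | apply/RA] => i j;
  by rewrite ?KE // -KE.
Qed.

(** For fixed [j], weight the equations for [A] at the columns l of [B] by Z_jl. The eigenvalues add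
    up to column [j] of B Z^T, and the eigenvector equation of [Z] evaluates the sum of Z_jl B_kl /
    B_xl. *)
Lemma nomura_eig_Jones A B Z Q : typeII A -> typeII B -> eig A B A B ->
  eig B^T (schur_inv B^T) Z Q -> eig A B (schur A Q^T) (B *m Z^T).
Proof.
move=> AII BII AB /eigE ZQ; have [_ A0 _] := AII; have [_ B0 _] := BII.
apply: typeII_eig => // x k j.
transitivity (\sum_l Z j l * \sum_i A x i * B i l / A k i).
  under [RHS]eq_bigr do rewrite mulr_sumr.
  rewrite exchange_big; apply: eq_bigr => i _ /=.
  rewrite mxE mulr_sumr mulr_suml.
  by apply: eq_bigr => l _; rewrite mxE; ring.
transitivity (n%:R * A x k * \sum_l Z j l * (B^T l k * schur_inv B^T l x)).
  rewrite mulr_sumr; apply: eq_bigr => l _.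
  by rewrite (eig_typeII n_gt0 AII B0 AB) !mxE; ring.
by rewrite ZQ !mxE; ring.
Qed.

(** Since [B] is invertible, S = B Z^T for a unique Z, and the preceding computation, read
    backwards, yields the equation for Z. *)
Lemma eig_nomura_Jones A B R S : typeII A -> typeII B -> eig A B A B ->
  eig A B R S ->
  eig B^T (schur_inv B^T) (invmx B *m S)^T (schur R (schur_inv A))^T.
Proof.
move=> AII BII AB RS; have [Fn A0 _] := AII; have [_ B0 _] := BII.
have n0 := char_coprime_neq0 n_gt0 Fn.
have Bu := typeII_unit n_gt0 BII.
apply/eigE=> k x j; set Z := (invmx B *m S)^T.
have SE : S = B *m Z^T by rewrite trmxK mulKVmx.
have nA0 : n%:R * A x k != 0 by rewrite mulf_neq0.
apply: (mulfI nA0); clearbody Z.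
transitivity (n%:R * (R x k * B k j / B x j)); last first.
  by rewrite !mxE; field; rewrite A0 B0.
rewrite -(eig_typeII n_gt0 AII B0 RS).
transitivity (\sum_l Z j l * \sum_i A x i * B i l / A k i).
  rewrite mulr_sumr; apply: eq_bigr => l _.
  by rewrite (eig_typeII n_gt0 AII B0 AB) !mxE; ring.
under eq_bigr do rewrite mulr_sumr.
rewrite exchange_big; apply: eq_bigr => i _ /=.
rewrite SE mxE mulr_sumr mulr_suml.
by apply: eq_bigr => l _; rewrite mxE; ring.
Qed.

End JonesNomura.

(** * The matrix W and its eigenvectors *)

Section Double.

Variables (F : fieldType) (n : nat) (A B : 'M[F]_n).

Definition double_mx : 'M[F]_(n + n) :=
  block_mx A (schur_inv B) (- A) (schur_inv B).

Lemma schur_inv_double : schur_inv double_mx =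
  block_mx (schur_inv A) B (- schur_inv A) B.
Proof.
rewrite /schur_inv /double_mx map_block_mx.
rewrite -/(schur_inv (schur_inv B)) schur_invK.
by congr block_mx; apply/matrixP=> i j; rewrite !mxE invrN.
Qed.

Lemma block_eig_same (P Q R T : 'M[F]_n) (v : 'cV[F]_n) a :
  block_mx P Q R T *m col_mx v v = a *: col_mx v v <->
  (P + Q) *m v = a *: v /\ (R + T) *m v = a *: v.
Proof.
rewrite mul_block_col scale_col_mx !mulmxDl.
by split=> [/eq_col_mx | [-> ->]].
Qed.

Lemma block_eig_opp (P Q R T : 'M[F]_n) (v : 'cV[F]_n) a :
  block_mx P Q R T *m col_mx v (- v) = a *: col_mx v (- v) <->
  (P - Q) *m v = a *: v /\ (T - R) *m v = a *: v.
Proof.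
rewrite mul_block_col scale_col_mx !mulmxBl !mulmxN scalerN -[R *m v - _]opprB.
by split=> [/eq_col_mx[-> /oppr_inj->] | [-> ->]].
Qed.

(** Left columns of W have the form (a, -a), right ones (b, b). Products of columns from the same
    side are (v, v) and see [P + Q] and [R + T]; mixed products are (u, -u) and see [P - Q] and
    [T - R]. *)
Lemma eig_double (P Q R T S11 S12 S21 S22 : 'M[F]_n) :
  eig double_mx (schur_inv double_mx)
      (block_mx P Q R T) (block_mx S11 S12 S21 S22) <->
  [/\ eig A (schur_inv A) (P + Q) S11 /\ eig A (schur_inv A) (R + T) S11,
      eig A B (P - Q) S12 /\ eig A B (T - R) S12,
      eig (schur_inv B) (schur_inv A) (P - Q) S21 /\
        eig (schur_inv B) (schur_inv A) (T - R) S21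
    & eig (schur_inv B) B (P + Q) S22 /\ eig (schur_inv B) B (R + T) S22].
Proof.
rewrite schur_inv_double /double_mx.
have colE (X Y Z U : 'M[F]_n) i j :
    schur (col_mx (col i X) (col i Y)) (col_mx (col j Z) (col j U)) =
    col_mx (schur (col i X) (col j Z)) (schur (col i Y) (col j U)).
  exact: map2_col_mx.
have schurN (u v : 'cV[F]_n) : schur (- u) v = - schur u v.
  by apply/matrixP=> x y; rewrite !mxE mulNr.
have schurNr (u v : 'cV[F]_n) : schur u (- v) = - schur u v.
  by apply/matrixP=> x y; rewrite !mxE mulrN.
have colN (X : 'M[F]_n) i : col i (- X) = - col i X by rewrite raddfN.
split=> [RS | [[S11P S11R] [S12P S12R] [S21P S21R] [S22P S22R]] i j].
  {
  have H11 i j := RS (lshift n i) (lshift n j).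
  have H12 i j := RS (lshift n i) (rshift n j).
  have H21 i j := RS (rshift n i) (lshift n j).
  have H22 i j := RS (rshift n i) (rshift n j).
  split; split=> i j.
  all: move: (H11 i j) (H12 i j) (H21 i j) (H22 i j).
  all: rewrite !block_mxEh !colKl !colKr -!block_mxEh !col_col_mx !colE.
  all: rewrite !colN !schurN !schurNr ?opprK.
  all: rewrite block_mxEul block_mxEur block_mxEdl block_mxEdr.
  all: move=> /block_eig_same[? ?] /block_eig_opp[? ?].
  all: by move=> /block_eig_opp[? ?] /block_eig_same[? ?].
  }
rewrite -[i]splitK -[j]splitK.
case: (split i) => {}i; case: (split j) => {}j; rewrite /unsplit.
all: rewrite !block_mxEh ?colKl ?colKr -!block_mxEh !col_col_mx !colE.
all: rewrite ?colN ?schurN ?schurNr ?opprK.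
all: rewrite ?block_mxEul ?block_mxEur ?block_mxEdl ?block_mxEdr.
all: by [apply/block_eig_same | apply/block_eig_opp].
Qed.

End Double.

Section DoubleTypeII.

Variables (F : fieldType) (n : nat) (A B : 'M[F]_n).
Hypothesis n_gt0 : (0 < n)%N.

Lemma typeII_double : char_coprime F (n + n) -> typeII A -> typeII B ->
  typeII (double_mx A B).
Proof.
move=> F2n AII BII; have [_ A0 AA] := AII; have [_ B0 BB] := BII.
split=> // [i j|].
  rewrite /double_mx -[i]splitK -[j]splitK.
  case: (split i) => {}i; case: (split j) => {}j; rewrite /unsplit;
  by rewrite ?block_mxEul ?block_mxEur ?block_mxEdl ?block_mxEdr ?mxE
             ?oppr_eq0 ?invr_eq0 ?A0 ?B0.
rewrite schur_inv_double /double_mx tr_block_mx mulmx_block.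
rewrite !linearN /= !mulNmx opprK AA.
have -> : schur_inv B *m B^T = n%:R%:M.
  by rewrite -[LHS]trmxK trmx_mul trmxK BB tr_scalar_mx.
by rewrite addNr -raddfD /= -natrD -scalar_mx_block.
Qed.

Definition double_plus (X : 'M[F]_n) : 'M[F]_(n + n) := block_mx X X X X.
Definition double_minus (Y : 'M[F]_n) : 'M[F]_(n + n) :=
  block_mx Y (- Y) (- Y) Y.

Fact double_plus_linear : linear double_plus.
Proof.
by move=> a X Y; rewrite /double_plus scale_block_mx add_block_mx.
Qed.
HB.instance Definition _ :=
  GRing.isLinear.Build F _ _ _ double_plus double_plus_linear.

Fact double_minus_linear : linear double_minus.
Proof.
move=> a X Y; rewrite /double_minus scale_block_mx add_block_mx.
by rewrite scalerN opprD.
Qed.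
HB.instance Definition _ :=
  GRing.isLinear.Build F _ _ _ double_minus double_minus_linear.

(** [theta] is defined by coordinates, hence linear on all matrices; this map can thus be passed to
    [linfun]. *)
Definition theta_twist (Z : 'M[F]_n) : 'M[F]_n := schur A (theta B^T Z)^T.

Fact theta_twist_linear : linear theta_twist.
Proof.
move=> a Y Z; apply/matrixP=> i j; rewrite !mxE mulmxDl -scalemxAl linearP /=.
by rewrite mulrDr mulrCA.
Qed.
HB.instance Definition _ :=
  GRing.isLinear.Build F _ _ _ theta_twist theta_twist_linear.

End DoubleTypeII.

(** * The Nomura algebra of W and its dimension *)

Section InvertibleDouble.

Variables (F : fieldType) (n : nat) (A B : 'M[F]_n).
Hypotheses (n_gt0 : (0 < n)%N) (F2n : char_coprime F (2 * n)).
Hypotheses (JAB : invertible_Jones_pair A B) (symA : A^T = A).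

Let Fn : char_coprime F n.
Proof. by move=> p /F2n; rewrite coprimeMr => /andP[]. Qed.
Let two0 : 2%:R != 0 :> F.
Proof.
by apply: char_coprime_neq0 => // p /F2n; rewrite coprimeMr => /andP[].
Qed.
Let AII : typeII A. Proof. exact: invertible_Jones_typeII_l JAB. Qed.
Let BII : typeII B. Proof. exact: invertible_Jones_typeII_r JAB. Qed.
Let WII : typeII (double_mx A B).
Proof. by apply: typeII_double => // p /F2n; rewrite mul2n addnn. Qed.
Let A0 : schur_invertible A. Proof. by case: AII. Qed.
Let B0 : schur_invertible B. Proof. by case: BII. Qed.
Let Au : A \in unitmx. Proof. exact: typeII_unit AII. Qed.
Let eAB : eig A B A B.
Proof. by case: JAB => [[/one_sided_Jones_eig]]. Qed.

Lemma nomura_double_plus X :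
  X \in nomura A -> double_plus X \in nomura (double_mx A B).
Proof.
move=> XA; have XB : X \in nomura B by rewrite -(nomura_Jones _ JAB).
have {}XA := memvD XA XA; have {}XB := memvD XB XB.
apply: (@eig_nomura _ _ _ _
  (block_mx (theta A (X + X)) 0 0 (theta B (X + X))^T)).
apply/eig_double; rewrite !subrr.
split; split; try exact: eig0.
1,2: exact: nomura_eig.
all: exact/eig_swap/nomura_eig.
Qed.

(** On the vectors (u, -u) the matrix acts as [A]. The block [B] is the eigenvector equation for (A,
    B), and [B^T] comes from the inverted pair by the symmetry of [A]. *)
Lemma theta_double_minus : theta (double_mx A B) (2%:R^-1 *: double_minus A) =
  block_mx 0 B B^T 0.
Proof.
have [_ W0 _] := WII; apply: eig_theta => //.
rewrite /double_minus scale_block_mx; apply/eig_double.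
rewrite !scalerN !subrr !addNr opprK.
have -> : 2%:R^-1 *: A + 2%:R^-1 *: A = A.
  by rewrite -mulr2n -scaler_nat scalerA divff // scale1r.
have eABi := eig_swap (eig_trmx n_gt0 AII B0 eAB); rewrite symA in eABi.
by split; split; try exact: eig0.
Qed.

Lemma nomura_double_minus Y :
  (exists S, eig A B Y S) -> double_minus Y \in nomura (double_mx A B).
Proof.
move=> YAB; have [S YS] := YAB.
have [S' YS'] := (eig_schur_inv_Jones n_gt0 Y Fn symA JAB).1 YAB.
apply: (@eig_nomura _ _ _ _ (block_mx 0 (2%:R *: S) (2%:R *: S') 0)).
apply/eig_double; rewrite subrr addNr opprK -!mulr2n -scaler_nat.
by split; split; by [apply: eig0 | apply: eig_scale].
Qed.

Lemma nomura_double_split R : R \in nomura (double_mx A B) ->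
  exists X Y, [/\ X \in nomura A, exists S, eig A B Y S
    & R = double_plus X + double_minus Y].
Proof.
have [_ W0 _] := WII; move=> /(nomura_eig W0); rewrite -[R]submxK.
set P := ulsubmx R; set Q := ursubmx R; set R' := dlsubmx R; set T := drsubmx R.
move: (theta _ _) => S; rewrite -[S]submxK => /eig_double [].
move=> [PQ RT] [PQ' RT'] _ _.
have Ai0 := schur_inv_invertible A0.
(* Two matrices with the same eigenvalues on the same basis are equal. Hence P + Q and P - Q
   determine all four blocks, as 2 is invertible. *)
have E1 : P + Q = R' + T := eig_inj Au Ai0 n_gt0 PQ RT.
have E2 : P - Q = T - R' := eig_inj Au B0 n_gt0 PQ' RT'.
exists (2%:R^-1 *: (P + Q)), (2%:R^-1 *: (P - Q)); split.
- by rewrite memvZ //; apply: eig_nomura PQ.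
- exists (2%:R^-1 *: ursubmx S) => i j.
  by rewrite -scalemxAl PQ' scalerA [in RHS]mxE.
have half (M N K : 'M[F]_n) : M + M = N + K -> M = 2%:R^-1 *: N + 2%:R^-1 *: K.
  move=> MNK; rewrite -scalerDr -MNK -mulr2n -scaler_nat.
  by rewrite scalerA mulVf // scale1r.
have [EP EQ] : P + P = (P + Q) + (P - Q) /\ Q + Q = (P + Q) - (P - Q).
  split; first by rewrite addrACA subrr addr0.
  by rewrite opprB [Q - P]addrC addrACA subrr add0r.
have ER : R' + R' = (P + Q) - (P - Q).
  by rewrite E2 E1 opprB addrACA subrr addr0.
have ET : T + T = (P + Q) + (P - Q).
  by rewrite E2 E1 addrACA [R' + _]addrC -addrACA subrr addr0.
by rewrite /double_plus /double_minus add_block_mx; congr block_mx;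
  rewrite -?scalerN; apply: half.
Qed.

Lemma theta_twist_eig Z : Z \in nomura B^T ->
  exists S, eig A B (theta_twist A B Z) S.
Proof.
have [_ Bt0 _] := typeII_tr n_gt0 BII.
by move=> /(nomura_eig Bt0) /(nomura_eig_Jones n_gt0 AII BII eAB) ?; eexists.
Qed.

Lemma eig_theta_twist Y : (exists S, eig A B Y S) ->
  exists2 Z, Z \in nomura B^T & Y = theta_twist A B Z.
Proof.
have [_ Bt0 _] := typeII_tr n_gt0 BII.
move=> [S /(eig_nomura_Jones n_gt0 AII BII eAB) YS].
exists (invmx B *m S)^T; first exact: eig_nomura YS.
rewrite /theta_twist (eig_theta Bt0 YS) trmxK.
by apply/matrixP=> i j; rewrite !mxE mulrCA divff // mulr1.
Qed.

Lemma theta_twist_inj Z : Z \in nomura B^T -> theta_twist A B Z = 0 -> Z = 0.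
Proof.
have BtII := typeII_tr n_gt0 BII; have [_ Bt0 _] := BtII.
move=> /(nomura_eig Bt0) ZQ /matrixP Z0.
have Bti0 := schur_inv_invertible Bt0.
apply: (eig_inj (typeII_unit n_gt0 BtII) Bti0 n_gt0 ZQ).
move=> i j; have := Z0 j i; rewrite [LHS]mxE [X in _ * X]mxE [RHS]mxE => /eqP.
by rewrite mulf_eq0 (negPf (A0 _ _)) => /eqP Zij; rewrite mul0mx Zij scale0r.
Qed.

Lemma dim_nomura_double :
  \dim (nomura (double_mx A B)) = (2 * \dim (nomura A))%N.
Proof.
have NB : nomura B^T = nomura A.
  by rewrite (nomura_Jones Fn (invertible_Jones_pair_tr JAB)).
pose f := linfun (@double_plus F n).
pose g := linfun (@double_minus F n \o theta_twist A B).
have -> : nomura (double_mx A B) = (f @: nomura A + g @: nomura B^T)%VS.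
  apply/eqP; rewrite eqEsubv; apply/andP; split.
    apply/subvP=> R /nomura_double_split[X [Y [XA YAB ->]]].
    have [Z ZB ->] := eig_theta_twist YAB.
    by apply/memv_add; apply/memv_imgP; [exists X | exists Z]; rewrite ?lfunE.
  rewrite subv_add; apply/andP; split; apply/subvP=> _ /memv_imgP[X XN ->].
    by rewrite lfunE; apply: nomura_double_plus.
  by rewrite lfunE; apply/nomura_double_minus/theta_twist_eig.
(* Comparing blocks forces X = Y = -Y, and 2 is invertible. So the sum is direct and, taking one
   side zero, both embeddings are injective. *)
have disj X Y : double_plus X = double_minus Y -> X = 0 :> 'M[F]_n /\ Y = 0.
  move=> /eq_block_mx[<- /eqP]; rewrite -addr_eq0 -mulr2n -scaler_nat.
  by rewrite scaler_eq0 (negPf two0) => /eqP->.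
rewrite dimv_disjoint_sum; last first.
  apply/eqP; rewrite -subv0; apply/subvP=> _ /memv_capP[/memv_imgP[X _ ->]].
  case/memv_imgP=> Z _; rewrite !lfunE => /disj[-> _].
  by rewrite linear0 mem0v.
rewrite !limg_dim_eq ?NB ?mul2n ?addnn //.
  apply/eqP; rewrite -subv0; apply/subvP=> Z /memv_capP[ZN].
  rewrite memv_ker lfunE /= memv0 => /eqP Z0; apply/eqP.
  rewrite -NB in ZN; apply: (theta_twist_inj ZN).
  suff /disj[] : double_plus 0 = double_minus (theta_twist A B Z) by [].
  by rewrite Z0 linear0.
apply/eqP; rewrite -subv0; apply/subvP=> X /memv_capP[XN].
rewrite memv_ker lfunE /= memv0 => /eqP X0.
have /disj[-> _] : double_plus X = double_minus 0 by rewrite X0 linear0.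
exact: eqxx.
Qed.

End InvertibleDouble.

Theorem corollary11p3 (F : fieldType) (n m : nat) (A B : 'M[F]_n)
    (n_gt0 : (0 < n)%N) (charF : char_coprime F (2 * n)%N)
    (JAB : invertible_Jones_pair A B) (symA : A^T = A)
    (dimNA : \dim (nomura A) = m) :
  let W : 'M[F]_(n + n) := block_mx A (schur_inv B) (- A) (schur_inv B) in
  let M : 'M[F]_(n + n) := block_mx A (- A) (- A) A in
  let N : 'M[F]_(n + n) := block_mx 0 B B^T 0 in
  [/\ typeII W,
      exists S : 'I_(2 * m - 1).+1 -> rel 'I_(n + n),
        [/\ assoc_scheme F S, Bose_Mesner F S = nomura W,
            (1 < n)%N -> imprimitive S & M \in Bose_Mesner F S],
      exists (d : nat) (S' : 'I_d.+1 -> rel 'I_(n + n)),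
        [/\ assoc_scheme F S', Bose_Mesner F S' = nomura W^T
          & N \in Bose_Mesner F S']
    & theta W (2%:R^-1 *: M) = N].
Proof.
move=> W M N; have Fn : char_coprime F n.
  by move=> p /charF; rewrite coprimeMr => /andP[].
have AII := invertible_Jones_typeII_l n_gt0 Fn JAB.
have BII := invertible_Jones_typeII_r Fn JAB.
have WII : typeII W.
  by apply: typeII_double => // p /charF; rewrite mul2n addnn.
have nn0 : (0 < n + n)%N by rewrite addn_gt0 n_gt0.
have MW : M \in nomura W.
  apply: nomura_double_minus => //; exists B.
  by case: JAB => [[/one_sided_Jones_eig]].
have thM : theta W (2%:R^-1 *: M) = N by apply: theta_double_minus.
split=> //; last first.
  have WtII := typeII_tr nn0 WII.
  have [d [S' [SS' BS']]] := nomura_scheme nn0 WtII.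
  exists d, S'; split=> //; rewrite BS'.
  (* Duality places the transpose of [N] in the algebra of [W^T], which is closed under
     transposition. *)
  have := theta_tr_nomura nn0 WII (memvZ 2%:R^-1 MW).
  by move=> /(nomura_trmx nn0 WtII); rewrite trmxK thM.
have [d [S [SS BS]]] := nomura_scheme nn0 WII.
have dE : d = (2 * m - 1)%N.
  have := dim_Bose_Mesner SS.
  rewrite BS (dim_nomura_double n_gt0 charF JAB symA).
  by rewrite dimNA => ->; rewrite subn1.
subst d; exists S; split=> //; last by rewrite BS.
(* The equivalence identifying i with n + i has 01-matrix [double_plus 1], hence is a union of
   relations. *)
move=> n_gt1; pose half (x : 'I_(n + n)) : 'I_n :=
  match split x with inl i | inr i => i end.
have lhalf (i : 'I_n) : half (lshift n i) = i.
  by rewrite /half (unsplitK (inl i)).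
have rhalf (i : 'I_n) : half (rshift n i) = i.
  by rewrite /half (unsplitK (inr i)).
have [I rI] : exists I : {set 'I_(2 * m - 1).+1},
    (fun x y => half x == half y) =2 [rel x y | [exists i in I, S i x y]].
  apply: Bose_Mesner_relation SS _; rewrite BS.
  move: (nomura_double_plus n_gt0 charF JAB (nomura_1 A)).
  congr (_ \in nomura W); apply/matrixP=> x y; rewrite /double_plus.
  rewrite -[x]splitK -[y]splitK.
  case: (split x) => {}x; case: (split y) => {}y; rewrite /unsplit;
  by rewrite ?block_mxEul ?block_mxEur ?block_mxEdl ?block_mxEdr
             !mxE ?lhalf ?rhalf.
exists I; split.
- by move=> x y z; rewrite -!rI; split=> // /eqP->.
(* Index 0 is related to its copy n, but, as n > 1, not to index 1. *)
- move=> /(_ (lshift n (Ordinal n_gt0)) (rshift n (Ordinal n_gt0))).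
  by rewrite -rI lhalf rhalf eqxx eq_lrshift.
- move=> /(_ (lshift n (Ordinal n_gt0)) (lshift n (Ordinal n_gt1))).
  by rewrite -rI !lhalf.
Qed.
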